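(* Let $e,r>1$ be integers. The reflection arrangement $\mathcal{A}^0_r$ of the complex reflection group $G(e,e,r)$ is combinatorially simplicial if and only if $e=2$ or $r=2$.
   Context: $G(e,e,r)\le\mathrm{GL}_r(\mathbb{C})$ is the group of $r\times r$ monomial matrices whose nonzero entries are $e$-th roots of unity with product $1$. The reflection arrangement of a finite complex reflection group is the set of its reflecting hyperplanes (fixed hyperplanes of its reflections), here in $\mathbb{C}^r$. An arrangement of hyperplanes is a finite set of hyperplanes in $V=K^r$; it is central if all hyperplanes are linear subspaces, and a central arrangement is essential if the intersection of all its hyperplanes is $0$. The intersection lattice $L(\mathcal{A})$ is the set of all intersections of elements of $\mathcal{A}$ (including $V$ as the empty intersection), ordered by reverse inclusion. The characteristic polynomial is $\chi_{\mathcal{A}}(t)=\sum_{X\in L(\mathcal{A})}\mu(X)t^{\dim X}$, where $\mu(X)=\mu(V,X)$ is the Möbius function of $L(\mathcal{A})$. For $X\in L(\mathcal{A})$ the restriction is $\mathcal{A}^X=\{X\cap H\mid H\in\mathcal{A},\ X\not\subseteq H,\ X\cap H\neq\emptyset\}$, an arrangement in $X$. A finite set $\mathcal{A}$ of hyperplanes in $K^r$ is (combinatorially) simplicial if it is a central, essential arrangement satisfying $r\chi_{\mathcal{A}}(-1)+2\sum_{H\in\mathcal{A}}\chi_{\mathcal{A}^H}(-1)=0$. *)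

(* Defs.v *)
From mathcomp Require Import all_boot all_order all_algebra.
From mathcomp Require Import finmap.
From mathcomp Require Import boolp classical_sets cardinality reals.
From mathcomp Require Import complex.

Set Implicit Arguments.
Unset Strict Implicit.
Unset Printing Implicit Defensive.

Import Order.TTheory GRing.Theory Num.Theory.

Local Open Scope ring_scope.

Section Arrangement.
Context {K : fieldType} {V : vectType K}.
Implicit Types (A L : {fset {vspace V}}) (U X Y Z H : {vspace V}).

(* Hyperplanes are linear, so every arrangement below is central and       *)
(* intersections are never empty. The ambient space is a subspace U of V,   *)
(* so that a restriction A^X is again an arrangement, in the ambient space  *)
(* X.                                                                       *)
Definition is_hyperplane U H : bool := (H <= U)%VS && ((\dim H).+1 == \dim U).

Definition is_arrangement U A : Prop := forall H, H \in A -> is_hyperplane U H.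

(* The empty subfamily contributes U itself. *)
Definition intersection_lattice U A : {fset {vspace V}} :=
  [fset (U :&: \bigcap_(H <- B) H)%VS | B : {fset {vspace V}} in fpowerset A]%fset.

Definition essential U A : bool :=
  (U :&: \bigcap_(H <- A) H == 0)%VS.

Definition restriction A X : {fset {vspace V}} :=
  [fset (X :&: H)%VS | H in A & ~~ (X <= H)%VS]%fset.

(* Moebius function of L ordered by REVERSE inclusion: the interval [X, Y]  *)
(* consists of the Z in L with Y <= Z <= X as subspaces. The recursion      *)
(* runs on the codimension of Y in X; see moebius_id, moebius_sum and       *)
(* moebius_out for the characteristic equations.                            *)
Fixpoint moebius_rec (n : nat) L X Y : int :=
  if X == Y then 1
  else if n is n'.+1 then
    - \sum_(Z <- L | [&& (Y <= Z)%VS, Z != Y & (Z <= X)%VS])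
        moebius_rec n' L X Z
  else 0.

Definition moebius L X Y : int :=
  if (Y <= X)%VS then moebius_rec (\dim X - \dim Y) L X Y else 0.

Definition char_poly_arr U A : {poly int} :=
  let L := intersection_lattice U A in
  \sum_(X <- L) moebius L U X *: 'X^(\dim X).

Lemma moebius_id L X : moebius L X X = 1.
Proof. by rewrite /moebius subvv subnn /= eqxx. Qed.

Lemma moebius_out L X Y : ~~ (Y <= X)%VS -> moebius L X Y = 0.
Proof. by rewrite /moebius => /negbTE ->. Qed.

Lemma moebius_rec_stable L X Y n : (Y <= X)%VS -> (\dim X - \dim Y <= n)%N ->
  moebius_rec n L X Y = moebius L X Y.
Proof.
rewrite /moebius => sYX; rewrite sYX.
move: {2}(\dim X - \dim Y)%N (leqnn (\dim X - \dim Y)%N) => d.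
elim: d Y n sYX => [|d IHd] Y n sYX.
  rewrite leqn0 => /eqP d0 _.
  have -> : X = Y.
    by apply/eqP; rewrite eq_sym eqEdim sYX /= -subn_eq0 d0.
  by rewrite subnn /= eqxx; case: n => [|n] /=; rewrite eqxx.
move=> le_d le_n; case: (eqVneq X Y) => [->|neXY].
  by rewrite subnn; case: n le_n => [|n] _ /=; rewrite eqxx.
have ltdim (Z W : {vspace V}) : (Z <= W)%VS -> W != Z -> (\dim Z < \dim W)%N.
  move=> sZW neWZ; rewrite ltnNge; apply: contra neWZ => dWZ.
  by rewrite eq_sym eqEdim sZW.
have dYX := ltdim _ _ sYX neXY.
case: n le_n => [|n] le_n.
  by move: le_n; rewrite leqn0 subn_eq0 leqNgt dYX.
case def_m: (\dim X - \dim Y)%N le_d le_n => [|m] le_d le_n.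
  by move/eqP: def_m; rewrite subn_eq0 leqNgt dYX.
rewrite /= (negbTE neXY); congr (- _); apply: eq_bigr => Z /and3P[sYZ neZY sZX].
have dYZ := ltdim _ _ sYZ neZY.
have leZm : (\dim X - \dim Z <= m)%N.
  by rewrite -ltnS -def_m ltn_sub2l.
rewrite (IHd Z n) ?(IHd Z m) //; first exact: leq_trans leZm _.
  exact: leq_trans leZm _.
exact: leq_trans leZm _.
Qed.

Lemma moebius_sum L X Y : Y \in L -> (Y <= X)%VS -> Y != X ->
  \sum_(Z <- L | (Y <= Z <= X)%VS) moebius L X Z = 0.
Proof.
move=> YL sYX neYX.
have muY : moebius L X Y = - \sum_(Z <- L |
    [&& (Y <= Z)%VS, Z != Y & (Z <= X)%VS]) moebius L X Z.
  rewrite {1}/moebius sYX.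
  have: (0 < \dim X - \dim Y)%N.
    rewrite subn_gt0 ltnNge; apply: contra neYX => dXY.
    by rewrite eqEdim sYX.
  case def_m: (\dim X - \dim Y)%N => [//|m] _ /=.
  rewrite eq_sym (negbTE neYX); congr (- _).
  apply: eq_bigr => Z /and3P[sYZ neZY sZX].
  rewrite moebius_rec_stable // -ltnS -def_m ltn_sub2l //.
    by rewrite -subn_gt0 def_m.
  by rewrite ltnNge; apply: contra neZY => dZY; rewrite eq_sym eqEdim sYZ.
rewrite big_mkcond (bigD1_seq Y YL (fset_uniq _)) /= subvv sYX muY.
apply/eqP; rewrite addrC subr_eq0 -big_mkcondr; apply/eqP; apply: eq_bigl => Z.
by rewrite andbCA.
Qed.

End Arrangement.

Definition combinatorially_simplicial (K : fieldType) (r : nat)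
    (A : {fset {vspace 'cV[K]_r}}) : Prop :=
  [/\ is_arrangement fullv A,
      essential fullv A &
      r%:R * (char_poly_arr fullv A).[-1]
        + 2 * \sum_(H <- A)
                (char_poly_arr H (restriction A H)).[-1] = 0].

Section Reflection.
Context {K : fieldType} {r : nat}.
Implicit Types (g : 'M[K]_r) (G : set 'M[K]_r).

(* Matrices act on column vectors by v |-> g *m v. *)
Definition fixed_space g : {vspace 'cV[K]_r} := fixedSpace (linfun (mulmx g)).

Lemma fixed_spaceP g (v : 'cV[K]_r) :
  reflect (g *m v = v) (v \in fixed_space g).
Proof. by apply: (iffP fixedSpaceP); rewrite lfunE. Qed.

Definition is_reflection g : bool := is_hyperplane fullv (fixed_space g).

Definition reflecting_hyperplanes G : set {vspace 'cV[K]_r} :=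
  [set H | exists g, [/\ G g, is_reflection g & H = fixed_space g]]%classic.

(* fset_set turns a finite classical set into an {fset _}; for a finite G   *)
(* the members are exactly the reflecting hyperplanes, see                  *)
(* reflection_arrangementP.                                                 *)
Definition reflection_arrangement G : {fset {vspace 'cV[K]_r}} :=
  fset_set (reflecting_hyperplanes G).

Lemma reflection_arrangementP G H : finite_set G ->
  H \in reflection_arrangement G <->
  exists g, [/\ G g, is_reflection g & H = fixed_space g].
Proof.
move=> finG; rewrite in_fset_set ?inE //.
apply: (@sub_finite_set _ _ (fixed_space @` G)%classic); last exact: finite_image.
by move=> _ [g [Gg _ ->]]; exists g.
Qed.

Definition monomial g : Prop :=
  (forall i, exists! j, g i j != 0) /\ (forall j, exists! i, g i j != 0).

Definition Geer (e : nat) : set 'M[K]_r :=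
  [set g | [/\ monomial g,
               forall i j, g i j != 0 -> g i j ^+ e = 1 &
               \prod_i \prod_(j | g i j != 0) g i j = 1]]%classic.

End Reflection.

Arguments Geer : clear implicits.

Lemma Geer_finite (K : closedFieldType) (r e : nat) : (0 < e)%N ->
  finite_set (Geer K r e).
Proof.
move=> e_gt0.
have [s def_s] := closed_field_poly_normal ('X^e - 1 : {poly K}).
have s_root x : x ^+ e = 1 -> x \in s.
  move=> xe1; have : root ('X^e - 1 : {poly K}) x.
    by rewrite /root !hornerE xe1 subrr.
  rewrite def_s lead_coefXnsubC // scale1r.
  by rewrite root_prod_XsubC.
pose f (t : {ffun 'I_r * 'I_r -> 'I_(size s).+1}) : 'M[K]_r :=
  \matrix_(i, j) nth 0 s (t (i, j)).
apply: (@sub_finite_set _ _ (f @` setT)%classic); last first.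
  exact/finite_image/finite_finset.
move=> g [_ g_root _].
exists [ffun p => inord (index (g p.1 p.2) s)] => //.
apply/matrixP => i j; rewrite mxE ffunE /= inordK ?ltnS ?index_size //.
case: (eqVneq (g i j) 0) => [g0|/g_root/s_root /nth_index -> //].
rewrite g0; case: (boolP (0 \in s)) => [/nth_index -> //|].
by rewrite -index_mem -leqNgt => /(nth_default 0) ->.
Qed.

(* Main.v *)
Require Import Defs.
From mathcomp Require Import all_boot all_order all_algebra.
From mathcomp Require Import reals complex.
From mathcomp Require Import perm separable cyclotomic finmap boolp ring.

(** Write A for the arrangement and e, r for the parameters. The reflections in
    G(e,e,r) are the transpositions twisted by an e-th root of unity, so A
    consists of the e * 'C(r, 2) hyperplanes x_i = a x_j with i != j and
    a ^+ e = 1 ([reflecting_hyperplanes_Geer], [arrangement_edges]).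
    The condition to be decided only involves values at -1 of characteristic
    polynomials, which are computed as follows.

    Whitney's theorem ([char_poly_whitney]) turns the Moebius sum into
    the alternating sum of t ^ dim over all subfamilies. Since this sum
    satisfies deletion-restriction by construction and depends only on the
    traces of the hyperplanes on the ambient space ([eq_whitney]), one can peel
    off a block B of hyperplanes such that on each H in B the other
    members of B only cut out traces of the hyperplanes that remain: every
    member of B then contributes the same restricted polynomial
    ([whitney_modular]). Applied to all hyperplanes involving one coordinate,
    this gives for the full monomial arrangement, that is, A together with the
    coordinate hyperplanes, F_n(t) = \prod_(k < n) (t - (k e + 1))
    ([whitney_full]). Applied to the coordinate hyperplanes, it gives
    F_r + r F_(r-1) for A ([char_poly_monomial]). The restriction of A to any
    of its members is the arrangement of the same shape in r - 1 coordinates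
    together with one coordinate hyperplane, with characteristic polynomial
    F_(r-1) + (r - 2) F_(r-2) ([char_poly_restriction]).

    At t = -1 everything is a multiple of F_(r-2)(-1), which is nonzero because
    all roots of F_(r-2) are positive, and the combinatorial simpliciality
    defect factors as F_(r-2)(-1) * r * (r - 2) * (e - 2)
    ([simplicial_defect]). *)

Set Implicit Arguments.
Unset Strict Implicit.
Unset Printing Implicit Defensive.

Import Order.TTheory GRing.Theory Num.Theory.

Local Open Scope ring_scope.

(** * Alternating sums over subfamilies and Whitney's theorem *)

Section WhitneySum.
Context {K : fieldType} {V : vectType K}.
Implicit Types (U X Y Z H : {vspace V}) (s B : seq {vspace V}).

(** Unfolding the recursion gives the sum over all subfamilies B of s of
    (-1) ^ #|B| times f at the intersection of U with the members of B. *)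
Fixpoint whitney (M : zmodType) (f : {vspace V} -> M) U s : M :=
  if s is H :: s' then whitney f U s' - whitney f (U :&: H)%VS s' else f U.

Section Values.
Context {M : zmodType}.
Variable f : {vspace V} -> M.

Lemma whitney_rem U s H : H \in s ->
  whitney f U s = whitney f U (rem H s) - whitney f (U :&: H)%VS (rem H s).
Proof.
elim: s U => //= G s IHs U; rewrite inE.
case: (eqVneq H G) => [<- _|neHG] //= Hs.
rewrite (IHs U Hs) (IHs (U :&: G)%VS Hs) -capvA (capvC G) capvA.
by rewrite !opprD !opprK addrACA.
Qed.

Lemma perm_whitney U s1 s2 : perm_eq s1 s2 -> whitney f U s1 = whitney f U s2.
Proof.
elim: s1 U s2 => [|H s1 IHs] U s2 eq12.
  by move: eq12; rewrite perm_sym => /perm_nilP->.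
have Hs2 : H \in s2 by rewrite -(perm_mem eq12) mem_head.
have eq1 : perm_eq s1 (rem H s2).
  by rewrite -(perm_cons H) (perm_trans eq12) // perm_to_rem.
by rewrite (whitney_rem U Hs2) /= !(IHs _ _ eq1).
Qed.

(** Choosing H or not does not change the intersection but changes the sign. *)
Lemma whitney_sub0 U s H : H \in s -> (U <= H)%VS -> whitney f U s = 0.
Proof. by move=> Hs /capv_idPl UH; rewrite (whitney_rem U Hs) UH subrr. Qed.

Lemma whitney_map_cap U s :
  whitney f U [seq (U :&: H)%VS | H <- s] = whitney f U s.
Proof.
suff cap X : (X <= U)%VS ->
    whitney f X [seq (U :&: H)%VS | H <- s] = whitney f X s by exact: cap.
elim: s X => //= H s IHs X XU.
rewrite capvA (capv_idPl XU) !IHs //.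
exact: subv_trans (capvSl _ _) XU.
Qed.

Lemma whitney_undup U s : whitney f U (undup s) = whitney f U s.
Proof.
elim: s U => //= H s IHs U; case: ifP => [Hs|_] /=; last by rewrite !IHs.
by rewrite IHs (whitney_sub0 Hs (capvSr _ _)) subr0.
Qed.

(** Only the traces on U of the members of a family enter the alternating
    sum, hence comparison up to intersection with U. *)
Definition trace_sub U s1 s2 : Prop :=
  {in s1, forall H, exists2 H', H' \in s2 & (U :&: H = U :&: H')%VS}.

(** By [whitney_sub0] a repeated trace can be dropped, so the alternating sum
    sees the set of traces and not their multiplicities. *)
Lemma eq_whitney U s1 s2 : trace_sub U s1 s2 -> trace_sub U s2 s1 ->
  whitney f U s1 = whitney f U s2.
Proof.
move=> s12 s21; rewrite -(whitney_map_cap U s1) -(whitney_map_cap U s2).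
rewrite -whitney_undup -[RHS]whitney_undup; apply/perm_whitney/uniq_perm.
- exact: undup_uniq.
- exact: undup_uniq.
move=> X; rewrite !mem_undup; apply/mapP/mapP => -[H Hs ->].
- by have [G] := s12 H Hs; exists G.
- by have [G] := s21 H Hs; exists G.
Qed.

Lemma whitney_absorb U B s : trace_sub U B s ->
  whitney f U (B ++ s) = whitney f U s.
Proof.
move=> sub; apply: eq_whitney => H; last first.
  by move=> Hs; exists H; rewrite ?mem_cat ?Hs ?orbT.
by rewrite mem_cat => /orP[/sub//|Hs]; exists H.
Qed.

(** Deleting the members of B one at a time, the restriction to H of what is
    left has the same traces as s alone, because H meets the rest of B in
    traces of s: each deletion costs exactly c. *)
Lemma whitney_modular U B s c :
  uniq B ->
  {in B, forall H, trace_sub (U :&: H) (rem H B) s /\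
                   whitney f (U :&: H)%VS s = c} ->
  whitney f U (B ++ s) = whitney f U s - c *+ size B.
Proof.
elim: B => [|H B IHB] /=; first by rewrite mulr0n subr0.
case/andP=> HB uB tr; have [tH cH] := tr H (mem_head _ _).
rewrite /= eqxx in tH; rewrite (whitney_absorb tH) cH IHB //.
  by rewrite mulrSr opprD addrA.
move=> G GB; have [tG cG] := tr G (mem_behead (s := H :: B) GB).
split=> // X XB; apply: tG; move: HB; rewrite /=; case: eqVneq => [->|_ _].
  by rewrite GB.
by rewrite inE XB orbT.
Qed.

End Values.

(** Grouping the subfamilies by their intersection; with f = t ^ dim the
    coefficients become the values of the Moebius function. *)
Lemma whitney_sum (R : pzRingType) (M : lmodType R) (L : seq {vspace V})
    (f : {vspace V} -> M) U s :
  uniq L -> U \in L -> {in L & s, forall X H, (X :&: H)%VS \in L} ->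
  whitney f U s = \sum_(X <- L) whitney (fun Y => (Y == X)%:R : R) U s *: f X.
Proof.
move=> uL; elim: s U => [|H s IHs] U UL capL /=.
  rewrite (bigD1_seq U) //= eqxx scale1r big1 ?addr0 // => X.
  by rewrite eq_sym => /negbTE->; rewrite scale0r.
rewrite IHs // ?IHs ?capL ?mem_head //; last 2 first.
- by move=> X G XL Gs; rewrite capL // inE Gs orbT.
- by move=> X G XL Gs; rewrite capL // inE Gs orbT.
by rewrite -sumrB; apply: eq_bigr => X _; rewrite scalerBl.
Qed.

(** The indicator of the subspaces above Y is multiplicative for
    intersections, so the alternating sum factors into terms 1 - [Y <= H]. *)
Lemma whitney_above Y U s :
  whitney (fun X => (Y <= X)%VS%:R : int) U s =
    ((Y <= U)%VS && ~~ has (fun H => Y <= H)%VS s)%:R.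
Proof.
elim: s U => [|H s IHs] U /=; first by rewrite andbT.
rewrite !IHs subv_cap.
by case: (Y <= U)%VS; case: (Y <= H)%VS; case: has.
Qed.

(** The equations on the upper sums form a triangular system, solved from U
    downwards. *)
Lemma moebius_unique U (L : {fset {vspace V}}) (w : {vspace V} -> int) :
  {in L, forall X, X <= U}%VS ->
  {in L, forall Y, \sum_(X <- L | (Y <= X)%VS) w X = (Y == U)%:R} ->
  {in L, forall X, w X = moebius L U X}.
Proof.
move=> LU sumw X; move: {2}(\dim U - \dim X)%N (leqnn (\dim U - \dim X)%N) => d.
have summ Y : Y \in L ->
    \sum_(X <- L | (Y <= X)%VS) moebius L U X = (Y == U)%:R.
  move=> YL; case: (eqVneq Y U) => [eqYU|neYU]; last first.
    rewrite -[RHS](moebius_sum YL (LU Y YL) neYU) big_seq_cond [RHS]big_seq_cond.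
    by apply: eq_bigl => Z; case: (boolP (Z \in L)) => //= /LU->; rewrite andbT.
  rewrite big_mkcond (bigD1_seq Y YL (fset_uniq _)) /= subvv eqYU moebius_id.
  rewrite big_seq_cond big1 ?addr0 // => Z /andP[/LU ZU neZU].
  by rewrite ifN //; apply: contraNN neZU => UZ; rewrite eqEsubv ZU.
elim: d X => [|d IHd] X leXd XL.
all: have := sumw X XL; rewrite -(summ X XL).
all: rewrite big_mkcond [in RHS]big_mkcond !(bigD1_seq X XL (fset_uniq _)) /= subvv.
all: suff -> : \sum_(Z <- L | Z != X) (if (X <= Z)%VS then w Z else 0) =
  \sum_(Z <- L | Z != X) (if (X <= Z)%VS then moebius L U Z else 0) by move/addIr.
all: rewrite big_seq_cond [RHS]big_seq_cond; apply: eq_bigr => Z /andP[ZL neZX].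
all: case: ifP => // XZ.
all: have ltXZ : (\dim X < \dim Z)%N
  by rewrite ltnNge; apply: contra neZX => ZX; rewrite eq_sym eqEdim XZ.
all: have := dimvS (LU Z ZL).
  by move/(leq_trans ltXZ); rewrite ltnNge -subn_eq0 -leqn0 leXd.
move=> ZU; apply: IHd => //; rewrite -ltnS (leq_trans _ leXd) // ltn_sub2l //.
exact: leq_trans ltXZ ZU.
Qed.

Lemma memv_cap_bigcap U s v :
  (v \in U :&: \bigcap_(H <- s) H)%VS =
  (v \in U) && all (fun H : {vspace V} => v \in H) s.
Proof.
rewrite memv_cap; congr (_ && _).
by elim: s => [|H s IHs] /=; rewrite ?big_nil ?memvf // big_cons memv_cap IHs.
Qed.

(** Whitney's theorem: the coefficient at X of the alternating sum satisfies
    the defining equations of the Moebius function, because by [whitney_above]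
    its sum over the elements above Y is 1 if Y = U, and is 0 otherwise, some
    member of A then containing Y. *)
Lemma char_poly_whitney U (A : {fset {vspace V}}) :
  {in A, forall H, ~~ (U <= H)%VS} ->
  char_poly_arr U A = whitney (fun X => 'X^(\dim X) : {poly int}) U A.
Proof.
move=> UA; rewrite /char_poly_arr /=; set L := intersection_lattice U A.
have memL X : reflect (exists2 B : {fset {vspace V}}, (B `<=` A)%fset &
    X = (U :&: \bigcap_(H <- B) H)%VS) (X \in L).
  apply: (iffP (imfsetP _ _ _ _)) => -[B /=].
    by rewrite fpowersetE => BA ->; exists B.
  by move=> BA ->; exists B; rewrite /= ?fpowersetE.
have UL : U \in L.
  by apply/memL; exists fset0; rewrite ?fsub0set // big_seq_fset0 capvf.
have capL : {in L & A, forall X H, (X :&: H)%VS \in L}.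
  move=> _ H /memL[B BA ->] HA; apply/memL; exists (H |` B)%fset.
    by rewrite fsubUset fsub1set HA.
  apply/vspaceP => v; rewrite memv_cap !memv_cap_bigcap -andbA; congr (_ && _).
  apply/andP/allP => [[/allP vB vH] G|vHB].
    by rewrite in_fset1U => /predU1P[->|/vB].
  split; last by apply: vHB; rewrite fset1U1.
  by apply/allP => G GB; apply: vHB; rewrite fset1Ur.
have LU : {in L, forall X, X <= U}%VS by move=> _ /memL[B _ ->]; apply: capvSl.
rewrite (whitney_sum (R := int) _ (fset_uniq L) UL capL).
rewrite big_seq [RHS]big_seq; apply: eq_bigr => X XL; congr (_ *: _).
apply/esym; move: X XL; apply: moebius_unique => // Y /[dup] YL /memL[B BA defY].
have -> : \sum_(X <- L | (Y <= X)%VS) whitney (fun Z => (Z == X)%:R : int) U A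
    = whitney (fun Z => (Y <= Z)%VS%:R : int^o) U A.
  rewrite (whitney_sum (R := int) _ (fset_uniq L) UL capL) big_mkcond.
  apply: eq_bigr => X _; case: (Y <= X)%VS; last by rewrite scaler0.
  by rewrite /GRing.scale /= mulr1.
rewrite whitney_above LU //=; congr (_%:R).
case: (eqVneq Y U) => [->|neYU].
  by congr nat_of_bool; apply/hasPn => H /UA.
apply/eqP; rewrite eqb0 negbK; apply/hasP; case: (fset_0Vmem B) => [B0|[H HB]].
  by rewrite defY B0 big_seq_fset0 capvf eqxx in neYU.
exists H; first exact: (fsubsetP BA).
apply/subvP => v; rewrite defY memv_cap_bigcap => /andP[_ /allP]; exact.
Qed.
End WhitneySum.

(** * Monomial arrangements *)

Lemma uniq_exists_neq (T : eqType) (s : seq T) x :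
  uniq s -> (1 < size s)%N -> exists2 y, y \in s & x != y.
Proof.
move=> us; rewrite ltnNge => /negP s_gt1; apply/hasP/negbNE/negP => /hasPn eqx.
apply/s_gt1/(@uniq_leq_size _ s [:: x] us) => y /eqx.
by rewrite negbK inE eq_sym.
Qed.

Section Mirrors.
Context {K : fieldType} {r : nat}.
Implicit Types (U H X : {vspace 'cV[K]_r}) (S Z : seq 'I_r) (i j k : 'I_r) (a b : K).

(** The hyperplane x_i = a x_j. The value a = 0 is allowed, and mirror i i 0 is
    the coordinate hyperplane x_i = 0, so that both kinds of hyperplanes are
    handled by the same lemmas. *)
Definition mirror i j a : {vspace 'cV[K]_r} :=
  lker (linfun (mulmx (delta_mx 0 i - a *: delta_mx 0 j : 'rV[K]_r))).

Lemma mirrorE i j a v : (v \in mirror i j a) = (v i 0 == a * v j 0).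
Proof.
rewrite memv_ker lfunE /= mulmxBl -scalemxAl -!rowE -[RHS]subr_eq0.
apply/eqP/eqP => [/matrixP/(_ 0 0)|eq0]; first by rewrite !mxE.
by apply/matrixP => k l; rewrite !ord1 !mxE.
Qed.

Lemma mirrorV i j a : a != 0 -> mirror i j a = mirror j i a^-1.
Proof.
move=> a0; apply/vspaceP => v; rewrite !mirrorE.
by rewrite -(inj_eq (mulfI (invr_neq0 a0))) mulKf // eq_sym.
Qed.

(** The vector with entries a at i and 1 at j lies on only one of the mirrors
    x_i = b x_k with k != i. *)
Lemma mirror_inj i j k a b : i != j -> i != k -> a != 0 ->
  mirror i j a = mirror i k b -> j = k /\ a = b.
Proof.
move=> ij ik a0 eqm.
have : delta_mx j 0 + a *: delta_mx i 0 \in mirror i k b.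
  rewrite -eqm mirrorE !mxE !eqxx (negbTE ij) (eq_sym j i) (negbTE ij) /=.
  by rewrite add0r mulr0 addr0.
rewrite mirrorE !mxE !eqxx (negbTE ij) (eq_sym k i) (negbTE ik) /= add0r mulr1.
rewrite mulr0 addr0; case: (eqVneq k j) => [-> /eqP|_]; first by rewrite mulr1.
by rewrite mulr0 (negbTE a0).
Qed.

Lemma coord_neq_mirror i j a : i != j -> a != 0 -> mirror i i 0 <> mirror i j a.
Proof.
move=> ij a0 eqm.
have : delta_mx j 0 + a *: delta_mx i 0 \in mirror i i 0.
  rewrite eqm mirrorE !mxE !eqxx (negbTE ij) (eq_sym j i) (negbTE ij) /=.
  by rewrite add0r mulr0 addr0.
by rewrite mirrorE !mxE !eqxx (negbTE ij) /= add0r mulr1 mul0r (negbTE a0).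
Qed.

(** The coordinates in S are linearly independent functions on U. This form is
    inherited by sections of U without any computation of ranks. *)
Definition free_on U S : Prop :=
  forall c : 'I_r -> K, exists2 u, u \in U & {in S, forall i, u i 0 = c i}.

Lemma free_on_sub U S S' : {subset S' <= S} -> free_on U S -> free_on U S'.
Proof. by move=> sub fr c; have [u uU uc] := fr c; exists u => // i /sub/uc. Qed.

Lemma free_on_fullv S : free_on fullv S.
Proof. by move=> c; exists (\col_i c i) => [|i _]; rewrite ?memvf ?mxE. Qed.

Lemma free_on_not_sub U S i j a : free_on U S -> i \in S -> i != j ->
  j \in S -> ~~ (U <= mirror i j a)%VS.
Proof.
move=> fr iS ij jS; have [u uU uc] := fr (fun k => (k == i)%:R).
apply/subvP => /(_ u uU); rewrite mirrorE !uc // eqxx (eq_sym j i) (negbTE ij).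
by rewrite mulr0 oner_eq0.
Qed.

Lemma free_on_not_sub0 U S i : free_on U S -> i \in S -> 
  ~~ (U <= mirror i i 0)%VS.
Proof.
move=> fr iS; have [u uU uc] := fr (fun _ => 1).
by apply/subvP => /(_ u uU); rewrite mirrorE !uc // mul0r oner_eq0.
Qed.

Lemma free_on_mirror U S i j a : uniq S -> i \in S ->
  (j \in rem i S) || (a == 0) ->
  free_on U S -> free_on (U :&: mirror i j a)%VS (rem i S).
Proof.
move=> uS iS ja fr c.
have [u uU uc] := fr (fun k => if k == i then a * c j else c k).
exists u => [|k]; last first.
  by rewrite mem_rem_uniq // => /andP[/= ki kS]; rewrite uc // (negbTE ki).
rewrite memv_cap uU mirrorE uc // eqxx.
case/orP: ja => [|/eqP->]; last by rewrite !mul0r eqxx.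
by rewrite mem_rem_uniq // => /andP[/= ji jS]; rewrite (uc j) // (negbTE ji).
Qed.

Lemma dim_cap_mirror U i j a : ~~ (U <= mirror i j a)%VS ->
  (\dim (U :&: mirror i j a)).+1 = \dim U.
Proof.
rewrite /mirror => nsub; set g := linfun _ in nsub *.
rewrite -(limg_ker_dim g U) -addn1; congr (_ + _)%N.
have le1 : (\dim (g @: U) <= 1)%N by rewrite (leq_trans (dimvS (subvf _))) ?dimvf.
by apply/eqP; rewrite eqn_leq le1 lt0n dimv_eq0 -lkerE nsub.
Qed.

(* mu lists the group of e-th roots of unity, with e = size mu. *)
Variable mu : seq K.
Hypotheses (mu_uniq : uniq mu) (mu1 : 1 \in mu) (mu_neq0 : {in mu, forall a, a != 0})
  (mu_div : {in mu &, forall a b, a / b \in mu}).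

Lemma mu_inv a : a \in mu -> a^-1 \in mu.
Proof. by move=> am; rewrite -div1r mu_div. Qed.

(** The arrangements are listed along a sequence S of coordinates, so that adding
    one coordinate i adds the star of i as a block. *)
Definition coords S := [seq mirror i i 0 | i <- S].
Definition star i S := [seq mirror i j a | j <- S, a <- mu].
(** Each unordered pair of coordinates is listed once, since x_i = a x_j and
    x_j = a^-1 x_i define the same hyperplane. *)
Fixpoint edges S := if S is i :: S' then star i S' ++ edges S' else [::].

Lemma edgesP S X : uniq S ->
  reflect (exists i j a, [/\ i \in S, j \in S, i != j, a \in mu & X = mirror i j a])
          (X \in edges S).
Proof.
elim: S => [|l S IHS] /=; first by move=> _; right=> -[i [j [a []]]].
case/andP=> lS /IHS{}IHS; rewrite mem_cat; apply: (iffP orP) => [[]|].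
- case/allpairsP => -[j a] /= [jS am ->]; exists l, j, a.
  split; rewrite ?mem_head ?inE ?jS ?orbT //.
  by apply: contraNneq lS => ->.
- case/IHS => i [j [a [iS jS ij am ->]]]; exists i, j, a.
  by split; rewrite ?inE ?iS ?jS ?orbT.
case=> i [j [a []]]; rewrite !inE.
case: (eqVneq i l) => [-> _|_ /= iS].
  case: (eqVneq j l) => [->//|_ /= jS].
  by move=> _ am ->; left; apply/allpairsP; exists (j, a).
case: (eqVneq j l) => [-> _|_ /= jS] il am defX.
  left; rewrite defX; apply/allpairsP; exists (i, a^-1); split=> //=; first exact: mu_inv.
  by rewrite mirrorV // mu_neq0.
by right; apply/IHS; exists i, j, a.
Qed.

Lemma starP i S X :
  reflect (exists j a, [/\ j \in S, a \in mu & X = mirror i j a]) (X \in star i S).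
Proof.
apply: (iffP allpairsP) => [[[j a] /= [jS am ->]]|[j [a [jS am ->]]]].
  by exists j, a.
by exists (j, a).
Qed.

Lemma star_uniq i S : i \notin S -> uniq S -> uniq (star i S).
Proof.
move=> iS uS; apply: allpairs_uniq => //.
move=> /= [j a] [k b] /allpairsP[[j' a'] /= [jS am [-> ->]]].
case/allpairsP=> [[k' b'] /= [kS bm [-> ->]]] eqm.
have [|||-> ->] // := mirror_inj _ _ _ eqm; last exact: mu_neq0.
  by apply: contraNneq iS => ->.
by apply: contraNneq iS => ->.
Qed.

Lemma edges_uniq S : uniq S -> uniq (edges S).
Proof.
elim: S => //= i S IHS /andP[iS uS]; rewrite cat_uniq star_uniq // IHS // andbT.
apply/hasPn => X /edgesP-/(_ uS)[k [l [b [kS lS kl bm ->]]]].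
apply/starP => -[j [a [jS am eqm]]].
have iN m : m \in S -> m == i = false.
  by move=> mS; apply/negbTE; apply: contraNneq iS => <-.
have : delta_mx i 0 \in mirror k l b by rewrite mirrorE !mxE !iN // mulr0.
by rewrite eqm mirrorE !mxE eqxx iN // mulr0 oner_eq0.
Qed.

Lemma size_edges S : size (edges S) = (size mu * 'C(size S, 2))%N.
Proof.
elim: S => [|i S IHS] /=; first by rewrite muln0.
by rewrite size_cat size_allpairs IHS binS bin1 mulnC -mulnDr addnC.
Qed.

Lemma cap_eq_in U H X : (forall v, v \in U -> (v \in H) = (v \in X)) ->
  (U :&: H = U :&: X)%VS.
Proof.
move=> eqHX; apply/vspaceP => v; rewrite !memv_cap.
by case: (boolP (v \in U)) => //= /eqHX.
Qed.

Lemma cap_coord_mirror U i j a : a != 0 ->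
  (U :&: mirror i i 0 :&: mirror i j a = U :&: mirror i i 0 :&: mirror j j 0)%VS.
Proof.
move=> a0; apply: cap_eq_in => v; rewrite memv_cap !mirrorE mul0r => /andP[_ /eqP->].
by rewrite mul0r [_ == a * _]eq_sym mulf_eq0 (negbTE a0).
Qed.

Lemma cap_mirror_coord U i j a : a != 0 ->
  (U :&: mirror i j a :&: mirror i i 0 = U :&: mirror i j a :&: mirror j j 0)%VS.
Proof.
move=> a0; apply: cap_eq_in => v; rewrite memv_cap !mirrorE !mul0r => /andP[_ /eqP->].
by rewrite mulf_eq0 (negbTE a0).
Qed.

Lemma cap_mirror_parallel U i j a b : a != b ->
  (U :&: mirror i j a :&: mirror i j b = U :&: mirror i j a :&: mirror j j 0)%VS.
Proof.
move=> ab; apply: cap_eq_in => v; rewrite memv_cap !mirrorE mul0r => /andP[_ /eqP->].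
by rewrite -subr_eq0 -mulrBl mulf_eq0 subr_eq0 (negbTE ab).
Qed.

Lemma cap_mirror_mirror U i j k a b : a != 0 ->
  (U :&: mirror i j a :&: mirror i k b = U :&: mirror i j a :&: mirror j k (b / a))%VS.
Proof.
move=> a0; apply: cap_eq_in => v; rewrite memv_cap !mirrorE => /andP[_ /eqP->].
by rewrite -(inj_eq (mulfI a0) (v j 0)) mulrA mulrCA divff // mulr1.
Qed.

(** The characteristic polynomial of the full monomial arrangement in n
    coordinates, inside a space of dimension n + m. *)
Definition full_poly m n : {poly int} :=
  'X^m * \prod_(k < n) ('X - (k * size mu + 1)%:R).

Let W := whitney (fun X : {vspace 'cV[K]_r} => 'X^(\dim X) : {poly int}).

(** Eliminating x_i between two hyperplanes that involve it leaves a relation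
    between the other coordinates: x_j = 0, or x_j = (b / a) x_k from
    x_i = a x_j and x_i = b x_k. *)
Lemma star_trace U i S H : i \notin S -> uniq S -> H \in mirror i i 0 :: star i S ->
  trace_sub (U :&: H) (rem H (mirror i i 0 :: star i S)) (coords S ++ edges S).
Proof.
move=> iS uS HB X.
have uB : uniq (mirror i i 0 :: star i S).
  rewrite /= star_uniq // andbT; apply/starP => -[j [a [jS am]]].
  by apply: coord_neq_mirror; [apply: contraNneq iS => -> | apply: mu_neq0].
rewrite mem_rem_uniq // => /andP[/= neXH XB].
have co j : j \in S -> mirror j j 0 \in coords S ++ edges S.
  by move=> jS; rewrite mem_cat (map_f (fun j => mirror j j 0)).
move: HB XB neXH; rewrite !inE.
case/predU1P=> [->|/starP[j [a [jS am ->]]]].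
  case/predU1P=> [->|/starP[j [a [jS am ->]]]]; first by rewrite eqxx.
  by exists (mirror j j 0); rewrite ?co // cap_coord_mirror // mu_neq0.
have a0 := mu_neq0 am.
case/predU1P=> [->|/starP[k [b [kS bm ->]]]] neq.
  by exists (mirror j j 0); rewrite ?co // cap_mirror_coord // mu_neq0.
case: (eqVneq j k) neq kS => [<- neq _|jk _ kS].
  have ab : a != b by apply: contraNneq neq => ->.
  by exists (mirror j j 0); rewrite ?co // cap_mirror_parallel.
exists (mirror j k (b / a)); last by rewrite cap_mirror_mirror.
rewrite mem_cat; apply/orP; right; apply/edgesP => //.
by exists j, k, (b / a); rewrite mu_div.
Qed.

(** Induction on the number of coordinates: the 1 + n e hyperplanes involving
    the new coordinate form a block as in [whitney_modular], each with the full
    monomial arrangement in the old coordinates as restriction. The space U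
    must vary, since the restrictions live in the hyperplanes. *)
Lemma whitney_full U S m : uniq S -> free_on U S -> \dim U = (size S + m)%N ->
  W U (coords S ++ edges S) = full_poly m (size S).
Proof.
elim: S U m => [|i S IHS] U m.
  by move=> _ _ dU; rewrite /W /= dU /full_poly big_ord0 mulr1.
case/andP=> iS uS fr dU.
have -> : W U (coords (i :: S) ++ edges (i :: S)) =
    W U ((mirror i i 0 :: star i S) ++ (coords S ++ edges S)).
  by apply/perm_whitney; rewrite /= perm_cons perm_catCA.
rewrite /W (whitney_modular (c := full_poly m (size S))).
- rewrite -/(W _ _) (IHS U m.+1) //=; last by rewrite dU addSnnS.
    by rewrite /full_poly big_ord_recr /= size_allpairs exprS -mulr_natr -addn1; ring.
  by apply: free_on_sub fr => j jS; rewrite inE jS orbT.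
- rewrite /= star_uniq // andbT; apply/starP => -[j [a [jS am]]].
  by apply: coord_neq_mirror; [apply: contraNneq iS => -> | apply: mu_neq0].
move=> H HB; split; first exact: star_trace.
have [j [a [-> ja nsub]]] : exists j a, [/\ H = mirror i j a, (j \in S) || (a == 0)
    & ~~ (U <= H)%VS].
  move: HB; rewrite inE => /predU1P[->|/starP[j [a [jS am ->]]]].
    by exists i, 0; rewrite eqxx orbT (free_on_not_sub0 fr) ?mem_head.
  exists j, a; rewrite jS (free_on_not_sub _ fr) ?mem_head ?inE ?jS ?orbT //.
  by apply: contraNneq iS => ->.
apply: IHS => //.
  have := @free_on_mirror U (i :: S) i j a; rewrite /= iS eqxx mem_head; exact.
by apply/succn_inj; rewrite dim_cap_mirror // dU addSn.
Qed.

Lemma coords_uniq Z : uniq Z -> uniq (coords Z).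
Proof.
move=> uZ; rewrite map_inj_in_uniq // => i j _ _ eqm; apply/eqP/negPn/negP => ij.
have : delta_mx j 0 \in mirror i i 0 by rewrite mirrorE !mxE (negbTE ij) mul0r.
by rewrite eqm mirrorE !mxE !eqxx mul0r oner_eq0.
Qed.

(** Each coordinate hyperplane x_i = 0 turns x_i = a x_k into x_k = 0, so the
    restriction to it is the full monomial arrangement in the other
    coordinates, whether or not further coordinate hyperplanes are present. *)
Lemma whitney_coords U S Z m : uniq S -> uniq Z -> {subset Z <= S} ->
  free_on U S -> \dim U = (size S + m)%N ->
  W U (coords Z ++ edges S) = W U (edges S) - full_poly m (size S).-1 *+ size Z.
Proof.
move=> uS uZ ZS fr dU.
rewrite -[size Z](size_map (fun i => mirror i i 0)) /W.
rewrite (whitney_modular (c := full_poly m (size S).-1)) //.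
  exact: coords_uniq.
move=> _ /mapP[i iZ ->]; have iS := ZS i iZ; split.
  move=> X; rewrite mem_rem_uniq; last exact: coords_uniq.
  case/andP=> /= neX /mapP[j jZ defX]; exists (mirror i j 1).
    apply/edgesP => //; exists i, j, 1; split=> //; first exact: ZS.
    by apply: contraNneq neX => ->; rewrite defX.
  by rewrite defX cap_coord_mirror ?oner_eq0.
have uT : uniq (rem i S) by rewrite rem_uniq.
have memT j : j \in rem i S = (j != i) && (j \in S) by rewrite mem_rem_uniq.
rewrite -(size_rem iS) -(whitney_full (U := U :&: mirror i i 0)) //.
- apply: eq_whitney => X; last first.
    rewrite mem_cat => /orP[/mapP[j]|/edgesP-/(_ uT)[j [k [a [jT kT jk am ->]]]]].
      rewrite memT => /andP[ji jS ->]; exists (mirror i j 1).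
        by apply/edgesP => //; exists i, j, 1; rewrite eq_sym.
      by rewrite cap_coord_mirror ?oner_eq0.
    exists (mirror j k a) => //; apply/edgesP => //; exists j, k, a.
    by move: jT kT; rewrite !memT => /andP[_ ->] /andP[_ ->].
  case/edgesP=> // j [k [a [jS kS jk am ->]]]; have a0 := mu_neq0 am.
  have co l : l != i -> l \in S -> mirror l l 0 \in coords (rem i S) ++ edges (rem i S).
    by move=> li lS; rewrite mem_cat (map_f (fun l => mirror l l 0)) ?memT ?li.
  case: (eqVneq j i) jk => [->|ji] jk.
    exists (mirror k k 0); first by rewrite co // eq_sym.
    by rewrite cap_coord_mirror.
  case: (eqVneq k i) jk => [->|ki] jk.
    exists (mirror j j 0); first exact: co.
    by rewrite (mirrorV j i a0) cap_coord_mirror // invr_neq0.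
  exists (mirror j k a) => //; rewrite mem_cat; apply/orP; right.
  by apply/edgesP => //; exists j, k, a; rewrite !memT ji ki.
- by apply: free_on_mirror; rewrite ?eqxx ?orbT.
- apply/succn_inj; rewrite dim_cap_mirror ?(free_on_not_sub0 fr) // dU.
  by rewrite -addSn size_rem // prednK // -has_predT; apply/hasP; exists i.
Qed.

(** Adding all the coordinate hyperplanes to the mirrors gives the full
    monomial arrangement, which determines the polynomial that was there
    before. *)
Lemma whitney_edges U S m : uniq S -> free_on U S -> \dim U = (size S + m)%N ->
  W U (edges S) = full_poly m (size S) + full_poly m (size S).-1 *+ size S.
Proof.
move=> uS fr dU; rewrite -(whitney_full uS fr dU).
by rewrite (whitney_coords uS uS _ fr dU) // subrK.
Qed.

(** Substituting x_i = a x_j turns the mirrors x_i = b x_k into mirrors between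
    j and k, and the parallel mirrors x_i = b x_j, where b != a, into x_j = 0.
    At least two roots of unity are needed for x_j = 0 to occur. *)
Lemma restriction_mirror U (A : {fset {vspace 'cV[K]_r}}) S i j a :
  (1 < size mu)%N -> uniq S -> A =i edges S -> free_on U S ->
  i \in S -> j \in S -> i != j -> a \in mu ->
  let H := (U :&: mirror i j a)%VS in
  W H (restriction A H) = W H (mirror j j 0 :: edges (rem i S)).
Proof.
move=> mu_gt1 uS defA fr iS jS ij am H; have a0 := mu_neq0 am.
have uT : uniq (rem i S) by rewrite rem_uniq.
have memT k : k \in rem i S = (k != i) && (k \in S) by rewrite mem_rem_uniq.
have jT : j \in rem i S by rewrite memT eq_sym ij.
have frH : free_on H (rem i S) by apply: free_on_mirror; rewrite ?jT.
have capHH X : (H :&: (H :&: X) = H :&: X)%VS by rewrite capvA capvv.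
have star_case k b : k \in S -> k != i -> b \in mu -> ~~ (H <= mirror i k b)%VS ->
    exists2 X, X \in mirror j j 0 :: edges (rem i S) & (H :&: mirror i k b = H :&: X)%VS.
  move=> kS ki bm; case: (eqVneq j k) => [<-|jk] nsub.
    have ab : a != b by apply: contraNneq nsub => <-; rewrite capvSr.
    by exists (mirror j j 0); rewrite ?mem_head // cap_mirror_parallel.
  exists (mirror j k (b / a)); last by rewrite cap_mirror_mirror.
  rewrite inE; apply/orP; right; apply/edgesP => //; exists j, k, (b / a).
  by rewrite !memT ki kS mu_div // jS eq_sym ij.
apply: eq_whitney => X.
  case/imfsetP=> G /=; rewrite inE /= defA => /andP[/edgesP-/(_ uS)].
  case=> k [l [b [kS lS kl bm ->]]] nsub ->; rewrite capHH.
  case: (eqVneq k i) kl nsub => [->|ki] kl nsub.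
    by apply: star_case; rewrite // eq_sym.
  case: (eqVneq l i) kl nsub => [->|li] kl nsub.
    by rewrite mirrorV ?mu_neq0 // in nsub *; apply: star_case; rewrite ?mu_inv.
  exists (mirror k l b) => //; rewrite inE; apply/orP; right.
  by apply/edgesP => //; exists k, l, b; rewrite !memT ki li.
have inA k l b : k \in S -> l \in S -> k != l -> b \in mu ->
    ~~ (H <= mirror k l b)%VS -> (H :&: mirror k l b)%VS \in restriction A H.
  move=> kS lS kl bm nsub; apply/imfsetP; exists (mirror k l b) => //=.
  by rewrite inE /= nsub andbT defA; apply/edgesP => //; exists k, l, b.
rewrite inE => /orP[/eqP->|/edgesP-/(_ uT)].
  have [b bm ab] := uniq_exists_neq a mu_uniq mu_gt1.
  exists (H :&: mirror i j b)%VS; last by rewrite capHH; apply/esym/cap_mirror_parallel.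
  apply: inA => //; apply: contra (free_on_not_sub0 frH jT) => /capv_idPl.
  by rewrite cap_mirror_parallel // => /capv_idPl.
case=> k [l [b [kT lT kl bm ->]]]; exists (H :&: mirror k l b)%VS; rewrite ?capHH //.
move: (kT) (lT); rewrite !memT => /andP[_ kS] /andP[_ lS]; apply: inA => //.
exact: free_on_not_sub frH _ _ _.
Qed.

End Mirrors.

(** * The reflecting hyperplanes of G(e,e,r) *)

Section Reflections.
Context {K : fieldType} {r : nat}.
Implicit Types (H X Y : {vspace 'cV[K]_r}) (i j k : 'I_r) (a b : K) (g : 'M[K]_r).

Lemma mirror_hyperplane i j a : i != j -> is_hyperplane fullv (mirror i j a).
Proof.
move=> ij; rewrite /is_hyperplane subvf -[mirror i j a]capfv dim_cap_mirror ?eqxx //.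

by apply: (free_on_not_sub (S := enum 'I_r)); rewrite ?mem_enum //; apply: free_on_fullv.
Qed.

Lemma coord_hyperplane i : is_hyperplane fullv (mirror i i 0 : {vspace 'cV[K]_r}).
Proof.
rewrite /is_hyperplane subvf -[mirror i i 0]capfv dim_cap_mirror ?eqxx //.
by apply: (free_on_not_sub0 (S := enum 'I_r)); rewrite ?mem_enum //; apply: free_on_fullv.
Qed.

Lemma hyperplane_eq X Y : is_hyperplane fullv X -> is_hyperplane fullv Y ->
  (X <= Y)%VS -> X = Y.
Proof.
case/andP=> _ /eqP dX /andP[_ /eqP dY] XY.
by apply/eqP; rewrite eqEdim XY -ltnS dX dY leqnn.
Qed.

(** The transposition of i and j, twisted so that the entries a and a^-1 have
    product 1. *)
Definition swap_mx i j a : 'M[K]_r := \matrix_(k, l)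
  if l == tperm i j k then (if k == i then a else if k == j then a^-1 else 1) else 0.

Lemma swap_mxM i j a (v : 'cV[K]_r) k : (swap_mx i j a *m v) k 0 =
  (if k == i then a else if k == j then a^-1 else 1) * v (tperm i j k) 0.
Proof.
rewrite mxE (bigD1 (tperm i j k)) //= mxE eqxx big1 ?addr0 // => l /negbTE lk.
by rewrite mxE lk mul0r.
Qed.

Lemma swap_fixed i j a : i != j -> a != 0 ->
  fixed_space (swap_mx i j a) = mirror i j a.
Proof.
move=> ij a0; apply/vspaceP => v; rewrite mirrorE.
apply/fixed_spaceP/eqP => [gv|vij]; first by rewrite -{1}gv swap_mxM eqxx tpermL.
apply/matrixP => k l; rewrite ord1 swap_mxM.
case: tpermP => [->|->|/eqP/negbTE-> /eqP/negbTE->]; rewrite ?mul1r //.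
  by rewrite eqxx.
by rewrite (eq_sym j i) (negbTE ij) eqxx vij mulKf.
Qed.

Lemma swap_Geer e i j a : i != j -> a != 0 -> a ^+ e = 1 ->
  Geer K r e (swap_mx i j a).
Proof.
move=> ij a0 ae1.
pose d k := if k == i then a else if k == j then a^-1 else 1.
have d0 k : d k != 0.
  by rewrite /d; case: ifP => // _; case: ifP; rewrite ?invr_eq0 ?oner_eq0.
have nz k l : (swap_mx i j a k l != 0) = (l == tperm i j k).
  by rewrite mxE; case: ifP => _; rewrite ?eqxx // -/(d k) d0.
split.
- split=> [k|l].
    by exists (tperm i j k); split=> [|l]; rewrite nz // => /eqP.
  exists (tperm i j l); split=> [|k]; rewrite nz ?tpermK // => /eqP->.
  by rewrite tpermK.
- move=> k l; rewrite nz mxE => ->; case: ifP => // _; case: ifP => _.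
    by rewrite exprVn ae1 invr1.
  by rewrite expr1n.
transitivity (\prod_k d k).
  apply: eq_bigr => k _; rewrite (eq_bigl (pred1 (tperm i j k))); last exact: nz.
  by rewrite big_pred1_eq mxE eqxx.
rewrite (bigD1 i) //= (bigD1 j) 1?eq_sym //= big1 => [|k /andP[/negbTE ki /negbTE kj]].
  by rewrite /d !eqxx (eq_sym j i) (negbTE ij) mulr1 divff.
by rewrite /d ki kj.
Qed.

(** Row i of the equation g v = v reads v_i = (g i j) v_j, so the fixed space lies in
    a mirror and is equal to it for dimension reasons. *)
Lemma Geer_off_diagonal e g : (exists i j, i != j /\ g i j != 0) ->
  Geer K r e g -> is_reflection g ->
  exists i j a, [/\ i != j, a ^+ e = 1 & fixed_space g = mirror i j a].
Proof.
case=> i [j [ij gij]] [[rowg _] ge _] refl; exists i, j, (g i j); split=> //.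
  exact: ge.
apply: hyperplane_eq => //; first exact: mirror_hyperplane.
apply/subvP => v /fixed_spaceP gv; rewrite mirrorE -{1}gv mxE (bigD1 j) //=.
rewrite big1 ?addr0 // => k kj; have [l [_ ul]] := rowg i.
case: (eqVneq (g i k) 0) => [->|/ul lk]; first by rewrite mul0r.
by rewrite -lk (ul j gij) eqxx in kj.
Qed.

(** A diagonal reflection has exactly one diagonal entry different from 1, and
    then its determinant is not 1. *)
Lemma Geer_diagonal e g : (forall i j, i != j -> g i j = 0) ->
  Geer K r e g -> ~~ is_reflection g.
Proof.
move=> diag [[rowg _] _ prodg]; apply/negP => refl.
have nz i : g i i != 0.
  have [l [gil _]] := rowg i; apply: contraNneq gil => gii.
  by case: (eqVneq i l) => [<-|/diag->]; rewrite ?gii.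
have gM (v : 'cV[K]_r) i : (g *m v) i 0 = g i i * v i 0.
  rewrite mxE (bigD1 i) //= big1 ?addr0 // => j; rewrite eq_sym => /diag->.
  exact: mul0r.
have {}prodg : \prod_i g i i = 1.
  rewrite -[RHS]prodg; apply: eq_bigr => i _.
  rewrite (eq_bigl (pred1 i)) ?big_pred1_eq // => j /=.
  case: (eqVneq j i) => [->|ji]; first exact: nz.
  by rewrite diag ?eqxx // eq_sym.
have [i gii] : exists i, g i i != 1.
  apply/existsP/negbNE; rewrite negb_exists; apply/negP => /forallP g1.
  move: refl; rewrite /is_reflection.
  have -> : fixed_space g = fullv.
    apply/vspaceP => v; rewrite memvf; apply/fixed_spaceP/matrixP => i k.
    by rewrite ord1 gM (eqP (negbNE (g1 i))) mul1r.
  by rewrite /is_hyperplane (gtn_eqF (ltnSn _)) andbF.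
(* The only diagonal entry of g other than 1 is the one at i. *)
have eqF : fixed_space g = mirror i i 0.
  apply: hyperplane_eq => //; first exact: coord_hyperplane.
  apply/subvP => v /fixed_spaceP/matrixP/(_ i 0); rewrite gM mirrorE mul0r => /eqP.
  by rewrite -subr_eq0 -{2}[v i 0]mul1r -mulrBl mulf_eq0 subr_eq0 (negbTE gii).
suff gj j : j != i -> g j j = 1.
  by move: gii; rewrite -prodg (bigD1 i) //= big1 ?mulr1 ?eqxx.
move=> ji; have : delta_mx j 0 \in fixed_space g.
  by rewrite eqF mirrorE mul0r mxE [i == j]eq_sym (negbTE ji).
by move/fixed_spaceP/matrixP/(_ j 0); rewrite gM !mxE !eqxx mulr1.
Qed.

Lemma reflecting_hyperplanes_Geer e H : (0 < e)%N ->
  reflecting_hyperplanes (Geer K r e) H <->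
  exists i j a, [/\ i != j, a ^+ e = 1 & H = mirror i j a].
Proof.
move=> e_gt0; split=> [[g [Gg refl ->]]|[i [j [a [ij ae1 ->]]]]].
  apply: Geer_off_diagonal (Gg) (refl); apply: contrapT => nodiag.
  move: (refl); apply/negP/(Geer_diagonal _ Gg) => i j ij.
  by apply: contrapT => /eqP gij; apply: nodiag; exists i, j.
have a0 : a != 0.
  by apply: contra_eq_neq ae1 => ->; rewrite expr0n gtn_eqF // eq_sym oner_eq0.
exists (swap_mx i j a); rewrite /is_reflection swap_fixed // mirror_hyperplane //.
by split=> //; apply: swap_Geer.
Qed.

End Reflections.

(** 'X^e - 1 is separable when e is invertible, so it has e distinct roots. *)
Lemma roots_of_unity (K : closedFieldType) e : e%:R != 0 :> K ->
  exists mu : seq K, [/\ uniq mu, size mu = e & forall a, (a \in mu) = (a ^+ e == 1)].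
Proof.
move=> e0.
have e_gt0 : (0 < e)%N by rewrite lt0n; apply: contraNneq e0 => ->.
have [mu def_mu] := closed_field_poly_normal ('X^e - 1 : {poly K}).
rewrite lead_coefXnsubC // scale1r in def_mu; exists mu; split.
- by rewrite -separable_prod_XsubC -def_mu separable_Xn_sub_1.
- by apply/succn_inj; rewrite -(size_prod_XsubC mu id) -def_mu size_XnsubC.
by move=> a; rewrite -root_prod_XsubC -def_mu /root !hornerE subr_eq0.
Qed.

(** * Characteristic polynomials and the simpliciality condition *)

Section MonomialArrangement.
Context {K : closedFieldType}.
Variables (r : nat) (mu : seq K).
Hypotheses (mu_gt1 : (1 < size mu)%N) (mu_uniq : uniq mu)
  (mu_root : forall a, (a \in mu) = (a ^+ size mu == 1)).

Let e := size mu.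
Let A := reflection_arrangement (Geer K r e).
Let S := enum 'I_r.

Let mu1 : 1 \in mu. Proof. by rewrite mu_root expr1n. Qed.

Let mu_neq0 : {in mu, forall a, a != 0}.
Proof.
move=> a; rewrite mu_root; apply: contraTneq => ->.
by rewrite expr0n gtn_eqF ?(ltnW mu_gt1) // eq_sym oner_eq0.
Qed.

Let mu_div : {in mu &, forall a b, a / b \in mu}.
Proof.
by move=> a b; rewrite !mu_root exprMn exprVn => /eqP-> /eqP->; rewrite invr1 mulr1.
Qed.

Let uS : uniq S. Proof. exact: enum_uniq. Qed.
Let memS i : i \in S. Proof. exact: mem_enum. Qed.

Let dimV : \dim {: 'cV[K]_r} = r. Proof. by rewrite dimvf /dim /= muln1. Qed.

Lemma arrangement_edges : A =i edges mu S.
Proof.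
move=> H; have e_gt0 : (0 < e)%N by rewrite ltnW.
have finG := Geer_finite K r e_gt0.
apply/idP/idP.
  case/(reflection_arrangementP _ finG)/(reflecting_hyperplanes_Geer _ e_gt0).
  move=> i [j [a [ij ae1 ->]]]; apply/edgesP => //.
  by exists i, j, a; rewrite mu_root ae1 ?memS.
case/edgesP=> // i [j [a [_ _ ij am ->]]].
apply/(reflection_arrangementP _ finG)/(reflecting_hyperplanes_Geer _ e_gt0).
by exists i, j, a; split=> //; apply/eqP; rewrite -mu_root.
Qed.

Lemma arrangement_perm : perm_eq A (edges mu S).
Proof.
apply: uniq_perm; [exact: fset_uniq | exact: edges_uniq | exact: arrangement_edges].
Qed.

Lemma arrangementP H : 
  reflect (exists i j a, [/\ i != j, a \in mu & H = mirror i j a]) (H \in A).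
Proof.
rewrite arrangement_edges; apply: (iffP (edgesP _ _ _ _ _)) => //.
  by case=> i [j [a [_ _ ij am ->]]]; exists i, j, a.
by case=> i [j [a [ij am ->]]]; exists i, j, a; rewrite !memS.
Qed.

Lemma monomial_is_arrangement : is_arrangement fullv A.
Proof. by move=> _ /arrangementP[i [j [a [ij am ->]]]]; apply: mirror_hyperplane. Qed.

(** With x_j = x_i and x_j = a x_i for some a != 1, every coordinate vanishes. *)
Lemma monomial_essential : (1 < r)%N -> essential fullv A.
Proof.
move=> r_gt1; rewrite /essential -subv0; apply/subvP => v.
rewrite memv_cap_bigcap => /andP[_ /allP vA]; rewrite memv0; apply/eqP/matrixP => i k.
rewrite ord1 !mxE.
have [j ji] : exists j : 'I_r, j != i.
  case: (eqVneq (val i) 0%N) => i0.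
    by exists (Ordinal r_gt1); rewrite -val_eqE /= i0.
  by exists (Ordinal (ltnW r_gt1)); rewrite -val_eqE /= eq_sym.
have [a am a1] := uniq_exists_neq 1 mu_uniq mu_gt1.
have vm b : b \in mu -> v j 0 = b * v i 0.
  by move=> bm; apply/eqP; rewrite -mirrorE vA //; apply/arrangementP; exists j, i, b.
have /eqP := vm a am; rewrite (vm 1) // -subr_eq0 -mulrBl mulf_eq0 subr_eq0.
by rewrite (negbTE a1) => /eqP.
Qed.

Lemma char_poly_monomial : char_poly_arr fullv A =
  full_poly mu 0 r + full_poly mu 0 r.-1 *+ r.
Proof.
rewrite char_poly_whitney; last first.
  move=> H /monomial_is_arrangement /andP[_ dH]; apply/negP => /dimvS.
  by rewrite -(eqP dH) ltnn.
rewrite (perm_whitney _ _ arrangement_perm).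
have dV : \dim {: 'cV[K]_r} = (size S + 0)%N.
  by rewrite dimV addn0 size_enum_ord.
rewrite (whitney_edges mu_uniq mu1 mu_neq0 mu_div uS (free_on_fullv S) dV).
by rewrite size_enum_ord.
Qed.

(** The restriction has all the mirrors in the r - 1 coordinates other than i,
    and x_j = 0: the full monomial arrangement in r - 1 coordinates with r - 2
    of the coordinate hyperplanes missing. *)
Lemma char_poly_restriction H : H \in A -> char_poly_arr H (restriction A H) =
  full_poly mu 0 r.-1 + full_poly mu 0 r.-2 *+ r.-2.
Proof.
case/arrangementP=> i [j [a [ij am ->]]].
rewrite char_poly_whitney; last first.
  move=> _ /imfsetP[X /= XA ->]; move: XA; rewrite inE /= => /andP[_ nsub].
  by apply: contra nsub; rewrite subv_cap => /andP[].
have fr : free_on {: 'cV[K]_r} S by apply: free_on_fullv.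
have frU : free_on (fullv :&: mirror i j a) (rem i S).
  by apply: free_on_mirror; rewrite ?memS // mem_rem_uniq // inE memS eq_sym ij.
have jT : j \in rem i S by rewrite mem_rem_uniq // inE memS eq_sym ij.
have := restriction_mirror mu_uniq mu1 mu_neq0 mu_div mu_gt1 uS arrangement_edges fr
  (memS i) (memS j) ij am.
have dimU : \dim (fullv :&: mirror i j a) = (size (rem i S) + 0)%N.
  apply/succn_inj; rewrite dim_cap_mirror; last exact: free_on_not_sub fr _ _ _.
  by rewrite dimV addn0 size_rem // size_enum_ord prednK // (leq_ltn_trans _ (ltn_ord i)).
have sT : size (rem i S) = r.-1 by rewrite size_rem // size_enum_ord.
move: frU dimU; rewrite capfv => frU dimU ->.
rewrite -[_ :: edges _ _]/(coords [:: j] ++ edges mu (rem i S)).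
have uT : uniq (rem i S) by rewrite rem_uniq.
rewrite (whitney_coords mu_uniq mu1 mu_neq0 mu_div uT _ _ frU dimU) //; last first.
  by move=> k; rewrite inE => /eqP->.
rewrite (whitney_edges mu_uniq mu1 mu_neq0 mu_div uT frU dimU) sT.
have : (0 < r.-1)%N by rewrite -sT; case: (rem i S) jT.
case: r.-1 => // n _ /=; rewrite mulr1n mulrS.
by rewrite (addrC (full_poly mu 0 n)) addrA addrK.
Qed.

Lemma full_polyS_horner n :
  (full_poly mu 0 n.+1).[-1] = (full_poly mu 0 n).[-1] * - (n%:R * e%:R + 2).
Proof.
rewrite /full_poly big_ord_recr /= mulrA hornerM; congr (_ * _).
by rewrite -polyC_natr hornerXsubC -/e; ring.
Qed.

Lemma full_poly_horner_neq0 n : (full_poly mu 0 n).[-1] != 0.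
Proof.
elim: n => [|n IHn]; first by rewrite /full_poly big_ord0 !hornerE.
by rewrite full_polyS_horner mulf_neq0 // oppr_eq0 -natrM -natrD pnatr_eq0 addn2.
Qed.

(** The left-hand side is the defining expression of combinatorial simpliciality
    for r = s + 2. Writing q for the value of F_s at -1, the values of F_(s+1)
    and F_(s+2) are q times one or two linear factors, and
    (2 + s e) ((s + 1) e - s) - e (s + 1) (2 + s e - s) = s (e - 2). *)
Lemma simplicial_defect s :
  s.+2%:R * (full_poly mu 0 s.+2 + full_poly mu 0 s.+1 *+ s.+2).[-1]
    + 2 * ((full_poly mu 0 s.+1 + full_poly mu 0 s *+ s).[-1] *+ (e * 'C(s.+2, 2)))
  = (full_poly mu 0 s).[-1] * s.+2%:R * s%:R * (e%:R - 2).
Proof.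
rewrite (hornerD (full_poly mu 0 s.+2)) (hornerD (full_poly mu 0 s.+1)) !hornerMn.
rewrite !full_polyS_horner; set q := (full_poly mu 0 s).[-1].
have binE : 'C(s.+2, 2)%:R * 2 = (s%:R + 2) * (s%:R + 1) :> int.
  by rewrite -natrM (bin_ffact s.+2 2) ffactnS ffactn1 natrM /=; ring.
rewrite mulrnA -[_ *+ 'C(_, _)]mulr_natr [2 * _]mulrC -[_ * 2]mulrA binE. ring.
Qed.

Lemma combinatorially_simplicialE : (1 < r)%N ->
  combinatorially_simplicial A <-> e = 2%N \/ r = 2%N.
Proof.
move=> r_gt1.
pose pH := full_poly mu 0 r.-1 + full_poly mu 0 r.-2 *+ r.-2.
have sumA : \sum_(H <- A) (char_poly_arr H (restriction A H)).[-1] =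
    pH.[-1] *+ (e * 'C(r, 2)).
  rewrite big_seq (eq_bigr (fun=> pH.[-1])) => [|H /char_poly_restriction-> //].
  rewrite -big_seq big_const_seq count_predT iter_addr_0 (perm_size arrangement_perm).
  by rewrite size_edges size_enum_ord.
rewrite /combinatorially_simplicial char_poly_monomial sumA.
have -> : e = 2%N \/ r = 2%N <->
    r%:R * (full_poly mu 0 r + full_poly mu 0 r.-1 *+ r).[-1] +
    2 * (pH.[-1] *+ (e * 'C(r, 2))) = 0.
  rewrite /pH -(subnK r_gt1) addn2 /= simplicial_defect; set s := (r - 2)%N.
  split=> [[->|[->]]|/eqP]; first by rewrite subrr mulr0.
    by rewrite mulr0 mul0r.
  rewrite !mulf_eq0 (negbTE (full_poly_horner_neq0 s)) !pnatr_eq0 /= subr_eq0 eqr_nat.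
  by case/orP => /eqP->; [right | left].
split=> [[] //|]; split=> //; first exact: monomial_is_arrangement.
exact: monomial_essential.
Qed.
End MonomialArrangement.

Local Close Scope ring_scope.

Theorem proposition6p2 (R : realType) (e r : nat) (he : (1 < e)%N) (hr : (1 < r)%N) :
  combinatorially_simplicial (reflection_arrangement (Geer (complex R) r e))
  <-> (e = 2 \/ r = 2).
Proof.
have e0 : (e%:R != 0 :> complex R)%R by rewrite pnatr_eq0 -lt0n ltnW.
have [mu [mu_uniq size_mu mu_root]] := roots_of_unity e0.
rewrite -size_mu in he mu_root *.
exact: combinatorially_simplicialE.
Qed.
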